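(* Let $B>0$, $1\le m<n$ be integers, $\epsilon_1,\epsilon_2>0$, $\epsilon=\epsilon_1+\epsilon_2$ and $\delta\ge 0$. Consider the following mechanism on input streams $\sigma\in[0,B]^n$. (1) It computes a threshold $\tau\in(0,B)$ from $\sigma(1),\dots,\sigma(m)$ only, by an $(\epsilon_1,\delta)$-differentially private algorithm, and releases $\tau$. (2) It releases $\hat{c}(\sigma,m)=\sum_{j=1}^{m}\min\{\sigma(j),\tau\}+Y$, where $Y$ is Laplace noise of mean $0$ and scale $\tau/\epsilon_2$. (3) For each $i=m+1,\dots,n$ it replaces $\sigma(i)$ by $\min\{\sigma(i),\tau\}$ and releases $\hat{c}(\sigma,i)=\hat{c}(\sigma,m)+\hat{s}(i)$, where $\hat{s}(i)$ is the output at time $i-m$ of the binary tree algorithm run on the truncated sub-stream of length $n-m$, with independent Laplace noise of mean $0$ and scale $\tau L/\epsilon$ at each tree node, $L$ being the number of levels of the tree. The noise in steps (2) and (3) is independent of the randomness of step (1) given $\tau$, and steps (2) and (3) use independent noise. Then the mechanism releasing $(\tau,\hat{c}(\sigma,m),\hat{c}(\sigma,m+1),\dots,\hat{c}(\sigma,n))$ is $(\epsilon,\delta)$-differentially private.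
   Context: Streams $\sigma,\sigma'\in[0,B]^n$ are adjacent if they differ in exactly one position. A randomized mechanism $M$ is $(\epsilon,\delta)$-differentially private if for all adjacent $\sigma,\sigma'$ and all measurable $S$, $\Pr[M(\sigma)\in S]\le e^{\epsilon}\Pr[M(\sigma')\in S]+\delta$; for the algorithm in step (1) this is applied to adjacent streams of length $m$. The Laplace distribution with mean $0$ and scale $s$ has density $\frac{1}{2s}e^{-|x|/s}$. Binary tree (BT) algorithm on a stream $x_1,\dots,x_N$: form a complete binary tree whose leaves are labelled by the intervals $[1,1],\dots,[N,N]$ (padding with zero entries to a power of two if necessary), each parent being labelled by the union of the intervals of its two children; $L$ is the number of levels, including leaves and root, so each index lies in exactly $L$ node intervals. To each node $[u,v]$ attach the noisy sum $\sum_{j=u}^{v}x_j$ plus an independent Laplace variable of the prescribed scale. The output at time $k$ is the sum of the noisy sums over the nodes in the standard dyadic decomposition of $[1,k]$ into disjoint node intervals. *)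

(* Defs.v *)
From HB Require Import structures.
From mathcomp Require Import all_boot all_order all_algebra.
From mathcomp Require Import all_classical all_reals all_analysis.
From mathcomp Require Import measurable_realfun.
Import Order.TTheory GRing.Theory Num.Theory.
Import numFieldNormedType.Exports.

Set Implicit Arguments.
Unset Strict Implicit.
Unset Printing Implicit Defensive.

Local Open Scope classical_set_scope.
Local Open Scope ring_scope.

(* Streams are 0-based: the entry of index i : 'I_n is the one at time i + 1. *)
Definition stream_in (R : realType) (B : R) n (s : 'I_n -> R) : Prop :=
  forall i, 0 <= s i <= B.

Definition adjacent (R : realType) n (s s' : 'I_n -> R) : Prop :=
  exists! i, s i <> s' i.

Definition prefix_stream (R : realType) m n (mn : (m <= n)%N)
    (s : 'I_n -> R) : 'I_m -> R :=
  fun i => s (widen_ord mn i).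

Definition suffix_stream (R : realType) m n (mn : (m <= n)%N)
    (s : 'I_n -> R) : 'I_(n - m) -> R :=
  fun i => s (cast_ord (subnKC mn) (rshift m i)).

(* [M s] is the law of the output on the stream s; the values of [M] outside
   [0, B]^n are irrelevant. *)
Definition differentially_private (R : realType) (B : R) n d
    (T : measurableType d) (eps delta : R)
    (M : ('I_n -> R) -> probability T R) : Prop :=
  forall s s' : 'I_n -> R, stream_in B s -> stream_in B s' -> adjacent s s' ->
  forall S : set T, measurable S ->
    (M s S <= (expR eps)%:E * M s' S + delta%:E)%E.

Definition laplace_pdf (R : realType) (b x : R) : R :=
  (2 * b)^-1 * expR (- `|x| / b).

(* A probability measure when 0 < b. *)
Definition laplace_prob (R : realType) (b : R) (V : set R) : \bar R :=
  (\int[lebesgue_measure]_(x in V) (laplace_pdf b x)%:E)%E.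

(* The leaves are padded to 2 ^ bt_height N, the least power of 2 that is at
   least N. *)
Definition bt_height (N : nat) : nat := up_log 2 N.

Definition bt_levels (N : nat) : nat := (bt_height N).+1.

(* Levels are counted from the leaves (level 0) to the root; level l has
   2 ^ (bt_height N - l) nodes, numbered from left to right. *)
Definition bt_node (N : nat) : finType :=
  {l : 'I_(bt_levels N) & 'I_(2 ^ (bt_height N - l))}.

(* The indices of the interval that labels a node: the node of number i at
   level l is labelled by the times i * 2 ^ l + 1, ..., (i + 1) * 2 ^ l. *)
Definition in_node N (v : bt_node N) (j : nat) : bool :=
  (tagged v * 2 ^ tag v <= j < (tagged v).+1 * 2 ^ tag v)%N.

(* The padding entries are zero, so only the indices j < N contribute. *)
Definition node_sum (R : realType) N (x : 'I_N -> R) (v : bt_node N) : R :=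
  \sum_(j < N | in_node v j) x j.

(* The dyadic decomposition of [1, k] follows the binary expansion of k: each
   digit 1, of weight 2 ^ l, contributes the node of level l whose interval
   ends at the time (k %/ 2 ^ l) * 2 ^ l. *)
Definition dyadic N (k : nat) (v : bt_node N) : bool :=
  odd (k %/ 2 ^ tag v) && ((tagged v).+1 == k %/ 2 ^ tag v)%N.

Definition bt_output (R : realType) N (x : 'I_N -> R) (noise : bt_node N -> R)
    (k : nat) : R :=
  \sum_(v : bt_node N | dyadic k v) (node_sum x v + noise v).

Section BinaryTreeFacts.
Local Open Scope nat_scope.

Lemma sum_bt_node N (F : nat -> nat -> nat) :
  \sum_(v : bt_node N) F (tag v) (tagged v) =
  \sum_(l < bt_levels N) \sum_(i < 2 ^ (bt_height N - l)) F l i.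
Proof.
by rewrite (sig_big_dep (fun l : 'I_(bt_levels N) => true) (fun _ _ => true)
  (fun l (i : 'I_(2 ^ (bt_height N - l))) => F l i)).
Qed.

Lemma card_in_node N j : j < 2 ^ bt_height N ->
  #|[set v : bt_node N | in_node v j]%SET| = bt_levels N.
Proof.
move=> jN; rewrite -sum1_card big_mkcond /=.
under eq_bigr do rewrite finset.inE.
rewrite (sum_bt_node N
  (fun l i => if i * 2 ^ l <= j < i.+1 * 2 ^ l then 1 else 0)).
transitivity (\sum_(l < bt_levels N) 1); last by rewrite sum1_card card_ord.
apply: eq_bigr => l _.
have lN : l <= bt_height N by rewrite -ltnS.
have jl : j %/ 2 ^ l < 2 ^ (bt_height N - l).
  by rewrite ltn_divLR ?expn_gt0 // -expnD subnK.
have E i : (i * 2 ^ l <= j < i.+1 * 2 ^ l) = (i == j %/ 2 ^ l).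
  by rewrite -leq_divRL ?expn_gt0 // -ltn_divLR ?expn_gt0 // ltnS -eqn_leq.
rewrite (bigD1 (Ordinal jl)) //= E eqxx big1 // => i ij.
by rewrite E ifN.
Qed.

Lemma dyadic_partition N k j : k <= 2 ^ bt_height N ->
  #|[set v : bt_node N | dyadic k v && in_node v j]%SET| = (j < k).
Proof.
move=> kN; rewrite -sum1_card big_mkcond /=.
under eq_bigr do rewrite finset.inE.
rewrite (sum_bt_node N (fun l i =>
  if odd (k %/ 2 ^ l) && (i.+1 == k %/ 2 ^ l) &&
     (i * 2 ^ l <= j < i.+1 * 2 ^ l) then 1 else 0)).
pose f l : nat := (j < k %/ 2 ^ l * 2 ^ l).
have fE l : f l.+1 = (j < (k %/ 2 ^ l)./2.*2 * 2 ^ l).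
  by rewrite /f expnSr divnMA (mulnC _ 2) mulnA divn2 muln2.
have fS l : f l.+1 <= f l.
  have h : (k %/ 2 ^ l)./2.*2 * 2 ^ l <= k %/ 2 ^ l * 2 ^ l.
    by rewrite leq_mul2r -muln2 -divn2 leq_divM orbT.
  by rewrite fE /f; case: ltnP => // /leq_trans /(_ h) ->.
transitivity (\sum_(0 <= l < bt_levels N) (f l - f l.+1)).
  rewrite big_mkord; apply: eq_bigr => l _.
  have lN : l <= bt_height N by rewrite -ltnS.
  rewrite fE /f.
  have : k %/ 2 ^ l <= 2 ^ (bt_height N - l).
    rewrite -(@leq_pmul2r (2 ^ l)) ?expn_gt0 // -expnD subnK //.
    exact: leq_trans (leq_divM _ _) kN.
  move: (k %/ 2 ^ l) => q ql.
  case: (boolP (odd q)) => oq /=; last by rewrite big1 // even_halfK // subnn.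
  have -> : q./2.*2 = q.-1 by rewrite -{2}(odd_double_half q) oq.
  case: q oq ql => // q oq ql /=.
  rewrite (bigD1 (Ordinal ql)) //= eqxx /= big1 ?addn0; last first.
    move=> i iq; rewrite ifN // eqSS; apply: contra iq => /andP[/eqP iq _].
    exact/eqP/val_inj.
  case: (leqP (q * 2 ^ l) j) => jq /=; first by case: ltnP.
  by rewrite (leq_trans jq) // leq_mul2r leqnSn orbT.
have -> : nat_of_bool (j < k) = f 0 - f (bt_levels N).
  rewrite /f expn0 divn1 muln1 divn_small ?subn0 //.
  by rewrite (leq_ltn_trans kN) // ltn_exp2l.
rewrite /bt_levels; elim: (bt_height N).+1 => [|h IH].
  by rewrite big_geq // subnn.
rewrite big_nat_recr //= IH addnBA ?fS // subnK //.
by elim: h {IH} => // h IH; exact: leq_trans (fS h) IH.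
Qed.

End BinaryTreeFacts.

Section Mechanism.
Context (R : realType) d (Omega : measurableType d) (m n : nat).
Variables (mn : (m <= n)%N) (s : 'I_n -> R).
Variables (tau Y : {mfun Omega >-> R}).
Variable Z : bt_node (n - m) -> {mfun Omega >-> R}.

Definition prefix_count (w : Omega) : R :=
  \sum_(j < m) Num.min (prefix_stream mn s j) (tau w) + Y w.

(* The count released at time m + k. *)
Definition private_count (k : nat) (w : Omega) : R :=
  prefix_count w +
  bt_output (fun j => Num.min (suffix_stream mn s j) (tau w))
            (fun v => Z v w) k.

Definition release (w : Omega) : (n - m).+2.-tuple R :=
  [tuple of tau w :: prefix_count w :: [tuple private_count k.+1 w | k < n - m]].

Lemma measurable_prefix_count : measurable_fun [set: Omega] prefix_count.
Proof.
apply: measurable_funD => //; apply: measurable_sum => j.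
exact: measurable_minr.
Qed.

Lemma measurable_private_count k : measurable_fun [set: Omega] (private_count k).
Proof.
apply: measurable_funD; first exact: measurable_prefix_count.
rewrite /bt_output; under eq_fun do rewrite big_mkcond.
apply: measurable_sum => v; case: (dyadic k v) => //.
apply: measurable_funD => //; rewrite /node_sum.
under eq_fun do rewrite big_mkcond.
apply: measurable_sum => j; case: (in_node v j) => //.
exact: measurable_minr.
Qed.

Lemma measurable_release : measurable_fun [set: Omega] release.
Proof.
apply: measurable_cons => //.
apply: measurable_cons; first exact: measurable_prefix_count.
apply/measurable_fun_tnthP => i.
rewrite (_ : _ \o _ = private_count i.+1).
  exact: measurable_private_count.
by apply/funext => w /=; rewrite tnth_mktuple.
Qed.

HB.instance Definition _ :=
  isMeasurableFun.Build _ _ _ _ release measurable_release.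

End Mechanism.

(* The conditional law of the noise given the threshold: given tau = t, the
   variables Y and Z v, for v a tree node, are independent, Y is Laplace of
   scale t / eps2 and each Z v is Laplace of scale t * L / eps. Only sets U of
   thresholds in ]0, B[ are considered, where these scales are positive; tau is
   almost surely there. *)
Definition noise_law (R : realType) d (Omega : measurableType d)
    (P : probability Omega R) (B eps2 eps : R) N
    (tau Y : {RV P >-> R}) (Z : bt_node N -> {RV P >-> R}) : Prop :=
  forall (U V : set R) (W : bt_node N -> set R),
    measurable U -> U `<=` `]0, B[%classic -> measurable V ->
    (forall v, measurable (W v)) ->
    P [set w | [/\ U (tau w), V (Y w) & forall v, W v (Z v w)]] =
    (\int[distribution P tau]_(t in U)
       (laplace_prob (t / eps2) V *
        \prod_(v : bt_node N)
          laplace_prob (t * (bt_levels N)%:R / eps) (W v)))%E.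

(* Main.v *)
Require Import Defs.
From HB Require Import structures.
From mathcomp Require Import all_boot all_order all_algebra.
From mathcomp Require Import all_classical all_reals all_analysis.
From mathcomp Require Import measurable_realfun ring lra.
Import Order.TTheory GRing.Theory Num.Theory.
Import numFieldNormedType.Exports.

(* Given the threshold t, the noise of scale t * b_i is t * b_i times a standard
   Laplace variable, so the law of (threshold, noise) is the image of
   D * Lap(1)^k, where D is the law of the threshold, under
   (t, z) |-> (t, (t * b_i * z_i)_i). In these coordinates, passing from s to an
   adjacent s' translates z, for each fixed t, by a vector a(t), and translating
   Lap(1)^k by a costs a factor exp(sum_i |a_i|). If s and s' differ in the prefix,
   only the noise of the prefix count is translated, by at most eps2, and D is
   replaced by its adjacent law. If they differ in the suffix, D is unchanged and
   the noise is translated at the L nodes above the entry, by at most eps / L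
   each. *)

Set Implicit Arguments.
Unset Strict Implicit.
Unset Printing Implicit Defensive.

Local Open Scope classical_set_scope.
Local Open Scope ring_scope.

(** * The standard Laplace distribution *)

Section Laplace.
Context {R : realType}.
Notation mu := (@lebesgue_measure R).

Lemma laplace_pdf_ge0 (b x : R) : 0 < b -> 0 <= laplace_pdf b x.
Proof.
by move=> b0; rewrite mulr_ge0 ?expR_ge0// invr_ge0 mulr_ge0// ltW.
Qed.

Lemma continuous_laplace_pdf (b : R) : continuous (laplace_pdf b).
Proof.
move=> x; apply: cvgM; first exact: cvg_cst.
apply: (cvg_comp _ expR); last exact: continuous_expR.
apply: cvgM; last exact: cvg_cst.
apply: (@cvgN _ R^o).
exact: (@norm_continuous _ R^o).
Qed.

Lemma measurable_laplace_pdf (b : R) : measurable_fun [set: R] (laplace_pdf b).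
Proof. by apply: continuous_measurable_fun; exact: continuous_laplace_pdf. Qed.

(** One map serves both changes of variable used on the noise: [a = 0] gives the rescaling, [b = 1]
    the translation. *)
Definition affine (b a x : R) : R := b * x + a.

Lemma measurable_affine (b a : R) : measurable_fun [set: R] (affine b a).
Proof. by apply: measurable_funD => //; apply: measurable_funM. Qed.

(** Lebesgue measure is determined by its values on the intervals []x, y]]. Preimages under
    [affine b a] divide their lengths by [b], so [b] times the pushforward takes the same values. *)
Lemma lebesgue_measure_affine (b a : R) (V : set R) : 0 < b -> measurable V ->
  mu V = (b%:E * mu (affine b a @^-1` V))%E.
Proof.
move=> b0 mV.
pose nu : {measure set (measurableTypeR R) -> \bar R} :=
  @mscale _ (measurableTypeR R) R (NngNum (ltW b0))
    (@pushforward _ _ (measurableTypeR R) (measurableTypeR R) R mu (affine b a)).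
rewrite [LHS](@lebesgue_measure_unique R (nu (measurable_affine b a)))// => {mV}V [[x y] _ <-].
change (mu `]x, y] = b%:E * mu (affine b a @^-1` `]x, y]))%E.
rewrite (_ : affine b a @^-1` _ =
   [set` `](x - a) / b, (y - a) / b]%R] :> set R); last first.
  apply/seteqP; split => z; rewrite /affine/= !in_itv/=;
    by rewrite ltr_pdivrMr// ler_pdivlMr// ltrBlDr lerBrDr (mulrC z b).
rewrite !lebesgue_measure_itv/= !lte_fin ltr_pM2r ?invr_gt0// ltrD2r.
case: ifPn => _; last by rewrite mule0.
rewrite -!EFinB -EFinM; congr EFin.
by rewrite -mulrBl mulrCA divff ?gt_eqF// mulr1 opprB addrA subrK.
Qed.

Lemma ge0_integral_affine (b a : R) (V : set R) (f : R -> R) : 0 < b ->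
  measurable V -> measurable_fun [set: R] f -> (forall x, 0 <= f x) ->
  (\int[mu]_(x in V) (f x)%:E =
   \int[mu]_(x in affine b a @^-1` V) (b * f (affine b a x))%:E)%E.
Proof.
move=> b0 mV mf f0.
have mg : measurable (affine b a @^-1` V).
  by rewrite -[_ @^-1` _]setTI; exact: measurable_affine.
pose nu : {measure set (measurableTypeR R) -> \bar R} :=
  @mscale _ (measurableTypeR R) R (NngNum (ltW b0))
    (@pushforward _ _ (measurableTypeR R) (measurableTypeR R) R mu (affine b a)).
have mfE : @measurable_fun _ _ (measurableTypeR R) _ V (EFin \o f).
  by apply: measurable_funTS; exact/measurable_EFinP.
transitivity (\int[nu (measurable_affine b a)]_(x in V) (f x)%:E)%E.
  by apply: eq_measure_integral => A mA _; exact: lebesgue_measure_affine.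
rewrite ge0_integral_mscale//=; last by move=> x _; rewrite lee_fin.
rewrite (@ge0_integral_pushforward _ _ (measurableTypeR R) (measurableTypeR R)
  R (affine b a) (measurable_affine b a))//=; last first.
  by move=> x _; rewrite lee_fin.
rewrite -ge0_integralZl_EFin//=.
- by move=> x _; rewrite lee_fin.
- apply: measurable_funTS; apply/measurable_EFinP.
  by apply: measurableT_comp => //; exact: measurable_affine.
- exact: ltW.
Qed.

(** The Jacobian [b] cancels the factor [1 / b] of the density: Laplace noise of scale [b] is [b]
    times standard Laplace noise. *)
Lemma laplace_prob_scale (b : R) (V : set R) : 0 < b -> measurable V ->
  laplace_prob b V = laplace_prob 1 ( *%R b @^-1` V).
Proof.
move=> b0 mV; rewrite /laplace_prob (@ge0_integral_affine b 0)//; last 2 first.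
- exact: measurable_laplace_pdf.
- by move=> x; exact: laplace_pdf_ge0.
rewrite (_ : affine _ _ @^-1` V = *%R b @^-1` V); last first.
  by apply/seteqP; split => x; rewrite /affine/= addr0.
apply: eq_integral => x _; congr EFin; rewrite /laplace_pdf /affine addr0.
have bn0 : b != 0 by rewrite gt_eqF.
rewrite normrM (gtr0_norm b0) mulrA invfM mulrCA divff// !mulr1 divr1.
by rewrite -mulrN mulrAC divff// mul1r.
Qed.

(** The scale is fixed at 1, where [laplace_prob] is a probability, so that the measure structures
    can be attached to this constant. *)
Definition std_laplace : set R -> \bar R := laplace_prob 1.

Let std_laplace0 : std_laplace set0 = 0%E.
Proof. by rewrite /std_laplace /laplace_prob integral_set0. Qed.

Let std_laplace_ge0 A : (0 <= std_laplace A)%E.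
Proof.
rewrite /std_laplace /laplace_prob integral_ge0//= => x _.
by rewrite lee_fin laplace_pdf_ge0.
Qed.

Let std_laplace_sigma_additive : semi_sigma_additive std_laplace.
Proof.
move=> /= F mF tF mUF; rewrite /std_laplace /laplace_prob; apply: cvg_toP.
  apply: ereal_nondecreasing_is_cvgn => m n mn.
  apply: lee_sum_nneg_natr => // k _ _; apply: integral_ge0 => /= x Fkx.
  by rewrite lee_fin laplace_pdf_ge0.
rewrite ge0_integral_bigcup//=.
- apply/measurable_funTS/measurableT_comp => //.
  exact: measurable_laplace_pdf.
- by move=> x _; rewrite lee_fin laplace_pdf_ge0.
Qed.

HB.instance Definition _ := isMeasure.Build _ _ _ std_laplace
  std_laplace0 std_laplace_ge0 std_laplace_sigma_additive.

(** The density is even, so the mass is twice that of the half-line, where twice the density is the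
    exponential density of rate 1. *)
Let std_laplace_setT : std_laplace [set: _] = 1%E.
Proof.
rewrite /std_laplace /laplace_prob ge0_symfun_integralT; last 3 first.
- by move=> x; exact: laplace_pdf_ge0.
- exact: continuous_laplace_pdf.
- by move=> x; rewrite /laplace_pdf/= normrN.
have mset : measurable [set x : R | 0 <= x] by rewrite -set_itvcy.
rewrite -ge0_integralZl_EFin//=; last 2 first.
- by move=> x _; rewrite lee_fin laplace_pdf_ge0.
- apply: measurable_funTS; apply/measurable_EFinP.
  exact: measurable_laplace_pdf.
rewrite -(@integral_exponential_pdf R 1)// integral_mkcond.
apply: eq_integral => x _; rewrite /exponential_pdf !patchE set_itvcy.
case: ifPn => //; rewrite inE/= => x0.
rewrite -EFinM /laplace_pdf mulr1 divr1 mulrA divff// !mul1r.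
by rewrite ger0_norm// mulN1r.
Qed.

HB.instance Definition _ :=
  @Measure_isProbability.Build _ _ R std_laplace std_laplace_setT.

(** Since [|x + a| <= |x| + |a|], the density at [x] is at most [expR |a|] times the density at
    [x + a]; this is integrated after the substitution [x + a]. *)
Lemma std_laplace_shift (a : R) (V : set R) : measurable V ->
  (std_laplace [set x | V (x + a)%R] <= (expR `|a|)%:E * std_laplace V)%E.
Proof.
move=> mV; rewrite /std_laplace /laplace_prob (@ge0_integral_affine 1 a V)//;
  last 2 first.
- exact: measurable_laplace_pdf.
- by move=> x; exact: laplace_pdf_ge0.
have SE : affine 1 a @^-1` V = [set x | V (x + a)].
  by apply/seteqP; split => x; rewrite /affine/= mul1r.
have mS : measurable [set x | V (x + a)].
  by rewrite -SE -[_ @^-1` _]setTI; exact: measurable_affine.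
rewrite SE.
rewrite -ge0_integralZl_EFin ?expR_ge0//; last 2 first.
- by move=> x _; rewrite lee_fin mul1r laplace_pdf_ge0.
- apply: measurable_funTS; apply/measurable_EFinP; apply: measurable_funM => //.
  apply: measurableT_comp; first exact: measurable_laplace_pdf.
  exact: measurable_affine.
apply: ge0_le_integral => //.
- by move=> x _; rewrite lee_fin laplace_pdf_ge0.
- apply: measurable_funTS; apply/measurable_EFinP.
  exact: measurable_laplace_pdf.
- apply: measurable_funTS; apply/measurable_EFinP; apply: measurable_funM => //.
  apply: measurable_funM => //.
  apply: measurableT_comp; first exact: measurable_laplace_pdf.
  exact: measurable_affine.
move=> x _; rewrite -EFinM lee_fin /affine !mul1r /laplace_pdf mulrCA.
rewrite ler_pM2l ?invr_gt0// -expRD ler_expR !divr1.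
by have := ler_normD x a; lra.
Qed.

End Laplace.

(** * Products of probabilities *)

Section ProductComparison.
Context {R : realType} d1 d2 {T1 : measurableType d1} {T2 : measurableType d2}.
Local Open Scope ereal_scope.

Lemma product_measure12E (P : probability T1 R) (Q : probability T2 R) E :
  measurable E -> (P \x Q) E = (P \x^ Q) E.
Proof.
move=> mE; apply: product_measure_unique => // A B mA mB.
exact: product_measure2E.
Qed.

(** The additive term passes through unchanged because a probability integrates a constant to
    itself. The pointwise bound is asked only on a set [D] of full measure, since noise laws will be
    compared only for thresholds in []0, B[]. *)
Lemma le_integral_affine d (T : measurableType d) (P : probability T R)
    (D : set T) (c a : R) (f g : T -> \bar R) :
  (0 <= c)%R -> (0 <= a)%R -> measurable D -> P D = 1 ->
  measurable_fun setT f -> measurable_fun setT g ->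
  (forall x, 0 <= f x) -> (forall x, 0 <= g x) ->
  (forall x, D x -> f x <= c%:E * g x + a%:E) ->
  \int[P]_x f x <= c%:E * \int[P]_x g x + a%:E.
Proof.
move=> c0 a0 mD PD mf mg f0 g0 fg.
have PC : P (~` D) = 0 by rewrite probability_setC// PD subee.
have mcg : measurable_fun setT (fun x => c%:E * g x) by exact: measurable_funeM.
rewrite -[a%:E]mule1 -[X in a%:E * X](@probability_setT _ _ _ P) -integral_cst//.
rewrite -ge0_integralZl_EFin// -ge0_integralD//; last first.
  by move=> x _; rewrite mule_ge0.
apply: ae_ge0_le_integral => //.
- by move=> x _; rewrite adde_ge0// mule_ge0.
- by apply: emeasurable_funD.
- exists (~` D); split => //; first exact: measurableC.
  by move=> x /= h Dx; apply: h => _; exact: fg.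
Qed.

Lemma le_product_xsection (P : probability T1 R) (Q Q' : probability T2 R)
    (D : set T1) (c a : R) (E F : set (T1 * T2)) :
  (0 <= c)%R -> (0 <= a)%R -> measurable D -> P D = 1 ->
  measurable E -> measurable F ->
  (forall x, D x -> Q (xsection E x) <= c%:E * Q' (xsection F x) + a%:E) ->
  (P \x Q) E <= c%:E * (P \x Q') F + a%:E.
Proof.
move=> c0 a0 mD PD mE mF h; apply: (le_integral_affine c0 a0 mD PD) => //.
- exact: measurable_fun_xsection.
- exact: measurable_fun_xsection.
Qed.

(** Integrating over the second factor last leaves, for each fixed [y], events of the first space
    only. This is how a privacy bound on the threshold carries over to events that also involve
    independent noise. *)
Lemma le_product_ysection (P P' : probability T1 R) (Q : probability T2 R)
    (c a : R) (E F : set (T1 * T2)) :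
  (0 <= c)%R -> (0 <= a)%R -> measurable E -> measurable F ->
  (forall y, P (ysection E y) <= c%:E * P' (ysection F y) + a%:E) ->
  (P \x Q) E <= c%:E * (P' \x Q) F + a%:E.
Proof.
move=> c0 a0 mE mF h; rewrite !product_measure12E//.
apply: (le_integral_affine (D := setT) c0 a0) => //.
- exact: probability_setT.
- exact: measurable_fun_ysection.
- exact: measurable_fun_ysection.
- by move=> y _; exact: h.
Qed.

End ProductComparison.

Lemma measurable_forall d (T : measurableType d) (I : finType)
    (A : I -> set T) : (forall i, measurable (A i)) ->
  measurable [set x | forall i, A i x].
Proof.
move=> mA; rewrite (_ : mkset _ = \bigcap_(i in setT) A i).
  by apply: fin_bigcap_measurable.
by apply/seteqP; split => x h i //; exact: h.
Qed.

(** * Finite powers of a probability *)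

Section IID.
Context {R : realType} d {T : measurableType d} (P : probability T R).

Definition tuple_cons n (xz : T * n.-tuple T) : n.+1.-tuple T :=
  [the n.+1.-tuple T of xz.1 :: xz.2].

Lemma measurable_tuple_cons n : measurable_fun setT (@tuple_cons n).
Proof. by apply: measurable_cons. Qed.

HB.instance Definition _ n := @isMeasurableFun.Build _ _ _ _
  (@tuple_cons n) (@measurable_tuple_cons n).

(** The power is built by prepending one independent draw, so that results on binary products lift
    to it by induction. *)
Fixpoint iid n : probability (n.-tuple T) R :=
  match n with
  | 0 => \d_([tuple] : 0.-tuple T)
  | n'.+1 => distribution (P \x iid n')%E (@tuple_cons n')
  end.

Lemma measurable_tuple_fun d' (T' : measurableType d') n
    (f : 'I_n -> T' -> T) : (forall i, measurable_fun setT (f i)) ->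
  measurable_fun setT (fun x => [tuple f i x | i < n]).
Proof.
move=> mf; apply/measurable_fun_tnthP => i.
rewrite (_ : _ \o _ = f i)//.
by apply/funext => x /=; rewrite tnth_mktuple.
Qed.

Lemma iid_box n (W : 'I_n -> set T) : (forall i, measurable (W i)) ->
  iid n [set z | forall i, W i (tnth z i)] = (\prod_(i < n) P (W i))%E.
Proof.
elim: n W => [|n IH] W mW.
  by rewrite big_ord0 /= diracE mem_set// => -[].
rewrite big_ord_recl -IH; last by move=> i; exact: mW.
rewrite -product_measure1E//; last first.
  apply: measurable_forall => i; rewrite -[X in measurable X]setTI.
  exact: (measurable_tnth i).

rewrite /= /pushforward; congr ((_ \x _)%E _).
apply/seteqP; split => -[x z] /=.
  by move=> h; split => [|i]; [exact: (h ord0)|have := h (lift ord0 i); rewrite tnthS].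
by move=> [h0 h] i; case: (unliftP ord0 i) => [j|] ->; rewrite ?tnthS.
Qed.

End IID.

(** Induction on the number of coordinates, translating one block at a time: the tail for each fixed
    head, then the head for each fixed tail. The factors multiply, so the exponents add up. *)
Lemma iid_std_laplace_shift (R : realType) n (a : 'I_n -> R)
    (E : set (n.-tuple R)) : measurable E ->
  (iid std_laplace n [set z | E [tuple (tnth z i + a i)%R | i < n]] <=
   (expR (\sum_(i < n) `|a i|))%:E * iid std_laplace n E)%E.
Proof.
elim: n a E => [|n IH] a E mE.
  rewrite big_ord0 expR0 mul1e /= !diracE lee_fin ler_nat.
  case: (boolP (_ \in _)) => //=; rewrite inE/= => h.
  by move: h; rewrite [X in E X]tuple0 => h; rewrite mem_set.
rewrite big_ord_recl expRD EFinM -muleA.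
pose shift (xz : R * n.-tuple R) : R * n.-tuple R :=
  (xz.1, [tuple tnth xz.2 i + a (lift ord0 i) | i < n]).
(* The intermediate event, in which only the head is translated. *)
pose E0 := [set xz : R * n.-tuple R | E (tuple_cons (xz.1 + a ord0, xz.2))].
have mE' : measurable (@tuple_cons _ R n @^-1` E).
  by rewrite -[_ @^-1` _]setTI; exact: measurable_tuple_cons.
have mE0 : measurable E0.
  have mf : measurable_fun setT
      (fun xz : R * n.-tuple R => (xz.1 + a ord0, xz.2)).
    by apply: measurable_fun_pair => //; exact: measurable_funD.
  by rewrite -[E0]setTI; exact: (mf measurableT _ mE').
have mE1 : measurable (shift @^-1` E0).
  have mf : measurable_fun setT shift.
    apply: measurable_fun_pair => //.
    apply: measurable_tuple_fun => i; apply: measurable_funD => //.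
    by apply: (measurableT_comp (measurable_tnth i)).
  by rewrite -[_ @^-1` _]setTI; exact: (mf measurableT _ mE0).
rewrite [leLHS](_ : _ = (std_laplace \x iid std_laplace n)%E
    (shift @^-1` E0)); last first.
  rewrite /= /pushforward; congr ((_ \x _)%E _).
  apply/funext => -[x z]; congr E.
  apply/eq_from_tnth => i; rewrite tnth_mktuple.
  by case: (unliftP ord0 i) => [j|] ->; rewrite ?tnthS ?tnth_mktuple.
have e0 := expR_ge0.
apply: (@le_trans _ _ ((expR (\sum_(i < n) `|a (lift ord0 i)|))%:E *
    (std_laplace \x iid std_laplace n)%E E0)%E).
  rewrite -[leRHS]adde0; apply: (le_product_xsection (D := setT)) => //.
    exact: probability_setT.
  move=> x _; rewrite adde0.
  rewrite (_ : xsection _ x = [set z | xsection E0 x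
    [tuple (tnth z i + a (lift ord0 i))%R | i < n]]); last first.
    by apply/funext => z; rewrite /xsection/= !in_setE.
  by apply: IH; exact: measurable_xsection.
rewrite muleCA; apply: lee_wpmul2l; first by rewrite lee_fin.
rewrite -[leRHS]adde0; apply: le_product_ysection => // y.
rewrite adde0.
rewrite (_ : ysection E0 y = [set x | ysection (@tuple_cons _ R n @^-1` E) y
  (x + a ord0)%R]); last by apply/funext => x; rewrite /ysection/= !in_setE.
by apply: std_laplace_shift; exact: measurable_ysection.
Qed.

(** * Joint law of the threshold and the noise *)

Section NoiseLaw.
Context {R : realType}.

Definition rectangle n (U : set R) (W : 'I_n -> set R) : set (R * n.-tuple R) :=
  [set x | U x.1 /\ forall i, W i (tnth x.2 i)].

Definition rectangles n : set (set (R * n.-tuple R)) :=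
  [set C | exists U W, [/\ measurable U, forall i, measurable (W i) &
                           C = @rectangle n U W]].

Lemma measurable_rectangle n U (W : 'I_n -> set R) :
  measurable U -> (forall i, measurable (W i)) -> measurable (rectangle U W).
Proof.
move=> mU mW; rewrite (_ : rectangle U W =
    U `*` [set z : n.-tuple R | forall i, W i (tnth z i)])//.
apply: measurableX => //; apply: measurable_forall => i.
by rewrite -[X in measurable X]setTI; exact: (measurable_tnth i).
Qed.

(** The threshold and every noise coordinate are measurable for the sigma-algebra generated by the
    rectangles, hence so is the identity into the product space. *)
Lemma rectangles_generate n :
  (@measurable _ (R * n.-tuple R)%type) = <<s @rectangles n >>.
Proof.
apply/seteqP; split => [E mE|]; last first.
  apply: smallest_sub; first exact: sigma_algebra_measurable.
  by move=> _ [U [W [mU mW ->]]]; exact: measurable_rectangle.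
have mid : @measurable_fun _ _ (g_sigma_algebraType (@rectangles n))
    (R * n.-tuple R)%type setT idfun.
  apply/measurable_fun_pairP; split.
    move=> _ U mU; rewrite setTI; apply: sub_sigma_algebra.
    exists U, (fun=> setT); split => //.
    by apply/seteqP; split => // x [].
  apply/measurable_fun_tnthP => i _ V mV; rewrite setTI.
  apply: sub_sigma_algebra.
  (* Constraining one coordinate is a rectangle with all other sides full. *)
  exists setT, (fun j => if j == i then V else setT); split => //.
    by move=> j; case: ifP.
  apply/seteqP; split => x /=.
    by move=> Vx; split => // j; case: eqP => // ->.
  by move=> [_ /(_ i)]; rewrite eqxx.
by have := mid measurableT _ mE; rewrite setTI.
Qed.

Definition scale_noise n (b : 'I_n -> R) (x : R * n.-tuple R) : R * n.-tuple R :=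
  (x.1, [tuple x.1 * b i * tnth x.2 i | i < n]).

Lemma measurable_scale_noise n (b : 'I_n -> R) :
  measurable_fun setT (scale_noise b).
Proof.
apply: measurable_fun_pair => //; apply: measurable_tuple_fun => i.
apply: measurable_funM; first by apply: measurable_funM.
exact: (measurableT_comp (measurable_tnth i)).
Qed.

HB.instance Definition _ n (b : 'I_n -> R) := @isMeasurableFun.Build _ _ _ _
  (scale_noise b) (measurable_scale_noise b).

Lemma probability_setI1 d (T : measurableType d) (P : probability T R)
    (D E : set T) : measurable D -> P D = 1%E -> measurable E ->
  P (E `&` D) = P E.
Proof.
move=> mD PD mE; apply/eqP; rewrite eq_le; apply/andP; split.
  by apply: le_measure; rewrite ?inE//; exact: measurableI.
have PC : P (~` D) = 0%E by rewrite probability_setC// PD subee.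
rewrite -[leRHS]adde0 -PC.
apply: (le_trans _ (measureU2 _ _ _)) => //; last 2 first.
- exact: measurableI.
- exact: measurableC.
apply: le_measure; rewrite ?inE//.
- by apply: measurableU; [exact: measurableI|exact: measurableC].
- by move=> x Ex; case: (pselect (D x)) => Dx; [left|right].
Qed.

(** For a fixed threshold [t], the section of the preimage of a rectangle is a box of sides rescaled
    by [t * b i], whose probability is a product of Laplace probabilities. *)
Lemma product_scale_noise n (b : 'I_n -> R) (D : probability R R) B
    (U : set R) (W : 'I_n -> set R) : D `]0, B[%classic = 1%E ->
  (forall i, 0 < b i) -> measurable U -> (forall i, measurable (W i)) ->
  distribution (D \x iid std_laplace n)%E (scale_noise b) (rectangle U W) =
  (\int[D]_(t in U `&` `]0%R, B[) \prod_(i < n) laplace_prob (t * b i)%R (W i))%E.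
Proof.
move=> DB b0 mU mW; rewrite /distribution /pushforward /= /product_measure1.
have mS : measurable (scale_noise b @^-1` rectangle U W).
  rewrite -[_ @^-1` _]setTI; apply: measurable_scale_noise => //.
  exact: measurable_rectangle.
have DC : D (~` `]0, B[%classic) = 0%E by rewrite probability_setC// DB subee.
(* Thresholds outside []0, B[] form a null set; inside, every scale [t * b i] is positive, as the
   rescaling of Laplace laws requires. *)
rewrite (ge0_negligible_integral _ _ _ _ DC)//; last 2 first.
- exact: measurableC.
- exact: measurable_fun_xsection.
rewrite setTD setCK integral_mkcond [RHS]integral_mkcond.
apply: eq_integral => t _; rewrite !patchE/=.
case: ifPn => tB; last first.
  by rewrite ifN//; apply: contra tB; rewrite !inE => -[].
have [t0 _] : 0 < t /\ t < B.
  by move: tB; rewrite inE/= in_itv/= => /andP.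
rewrite in_setI tB andbT; case: ifPn => tU; last first.
  rewrite (_ : xsection _ t = set0) ?measure0//.
  apply/seteqP; split => z //; rewrite /xsection/= inE => -[/= Ut _].
  by case/negP: tU; rewrite inE.
rewrite (_ : xsection _ t = [set z | forall i,
    (( *%R (t * b i)) @^-1` W i) (tnth z i)]); last first.
  apply/seteqP; split => z; rewrite /xsection/= inE.
    by move=> [_ h] i; have := h i; rewrite tnth_mktuple.
  by move=> h; split => [|i]; [move: tU; rewrite inE|rewrite tnth_mktuple].
transitivity (\prod_(i < n) std_laplace ( *%R (t * b i) @^-1` W i))%E.
  apply: (@iid_box _ _ _ std_laplace n (fun i => *%R (t * b i) @^-1` W i)) => i.
  by rewrite -[X in measurable X]setTI; exact: measurable_funM.
by apply: eq_bigr => i _; rewrite [RHS]laplace_prob_scale// mulr_gt0.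
Qed.

(** Both sides are finite measures that agree on rectangles, a generating class stable under
    intersection, so they agree on all measurable sets. *)
Lemma noise_joint_law n (b : 'I_n -> R) d (Omega : measurableType d)
    (P : probability Omega R) (tau : {RV P >-> R}) (Z : 'I_n -> {RV P >-> R}) B :
  distribution P tau `]0, B[%classic = 1%E ->
  (forall i, 0 < b i) ->
  (forall U W, measurable U -> U `<=` `]0, B[%classic ->
    (forall i, measurable (W i)) ->
    P [set w | U (tau w) /\ forall i, W i (Z i w)] =
    (\int[distribution P tau]_(t in U)
      \prod_(i < n) laplace_prob (t * b i)%R (W i))%E) ->
  forall E, measurable E ->
  P [set w | E (tau w, [tuple Z i w | i < n])] =
  (distribution P tau \x iid std_laplace n)%E (scale_noise b @^-1` E).
Proof.
move=> tB b0 ZE E mE.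
pose X w := (tau w, [tuple Z i w | i < n]).
have mX : measurable_fun setT X.
  by apply: measurable_fun_pair => //; exact: measurable_tuple_fun.
pose Xm : {mfun Omega >-> (R * n.-tuple R)%type} :=
  HB.pack X (isMeasurableFun.Build _ _ _ _ X mX).
apply: (@measure_unique _ _ _ (@rectangles n) (fun=> setT)
  (rectangles_generate n) _ _ _ (distribution P Xm)
  (distribution (distribution P tau \x iid std_laplace n)%E (scale_noise b))) => //.
- move=> _ _ [U [W [mU mW ->]]] [U' [W' [mU' mW' ->]]].
  exists (U `&` U'), (fun i => W i `&` W' i); split => //.
  + exact: measurableI.
  + by move=> i; exact: measurableI.
  + apply/seteqP; split => x.
      by move=> [[Ux Wx] [U'x W'x]]; split => // i.
    by move=> [[Ux U'x] h]; split; split => // i; have [] := h i.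
- move=> _; exists setT, (fun=> setT); split => //.
  by apply/seteqP; split.
- by rewrite bigcup_const//; exists 0%N.
- move=> _ [U [W [mU mW ->]]].
  apply: etrans (esym (product_scale_noise tB b0 mU mW)).
  (* The law of the noise is given only over sets of thresholds inside []0, B[]. Intersecting with
     this almost sure event reaches an arbitrary [U]. *)
  rewrite -ZE//; last exact: measurableI.
  rewrite /distribution /pushforward.
  have mt : measurable (tau @^-1` `]0, B[).
    exact: measurable_funPTI.
  have mr : measurable (X @^-1` rectangle U W).
    rewrite -[X in measurable X]setTI.
    exact: (mX measurableT _ (measurable_rectangle mU mW)).
  apply: etrans (esym (probability_setI1 mt tB mr)) _.
  congr (P _); apply/seteqP; split => w /=.
    by move=> [[Uw Ww] tw]; split => // i; have := Ww i; rewrite tnth_mktuple.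
  by move=> [[Uw tw] h]; split => //; split => // i; rewrite tnth_mktuple.
- move=> _; exact: (le_lt_trans (probability_le1 _ _) (ltry _)).
Qed.

End NoiseLaw.

(** * The release and its sensitivity *)

Lemma big_option (T : Type) (idx : T) (op : Monoid.com_law idx) (I : finType)
    (F : option I -> T) :
  \big[op/idx]_(i : option I) F i =
  op (F None) (\big[op/idx]_(i : I) F (Some i)).
Proof.
rewrite (bigD1 None)//=; congr (op _ _).
rewrite (reindex_omap Some id)/=; last by case.
by apply: eq_bigl => i; rewrite eqxx.
Qed.

(** Only the summand of index [i] can change, and both of its clipped values lie in [[0, t]]. *)
Lemma clipped_sum_sensitivity (R : realType) N (x y : 'I_N -> R) (Q : pred 'I_N)
    (t : R) (i : 'I_N) :
  (forall j, 0 <= x j) -> (forall j, 0 <= y j) -> 0 <= t ->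
  (forall j, j != i -> x j = y j) ->
  `|\sum_(j | Q j) Num.min (x j) t - \sum_(j | Q j) Num.min (y j) t| <=
  if Q i then t else 0.
Proof.
move=> x0 y0 t0 xy; rewrite -sumrB big_mkcond (bigD1 i)//= big1 ?addr0; last first.
  by move=> j ji; rewrite xy// subrr if_same.
case: ifP => _; last by rewrite normr0.
have c z : 0 <= z -> 0 <= Num.min z t <= t.
  by move=> z0; rewrite le_min z0 t0 ge_min lexx orbT.
have /andP[] := c _ (x0 i); have /andP[] := c _ (y0 i).
by rewrite ler_norml; lra.
Qed.

Section CanonicalRelease.
Context {R : realType} {m n : nat} (mn : (m <= n)%N).

(* [None] indexes the noise of the prefix count. *)
Definition noise_index : finType := option (bt_node (n - m)).

Notation K := #|{: noise_index}|.

Definition threshold (x : R * K.-tuple R) : R := x.1.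

HB.instance Definition _ := @isMeasurableFun.Build _ _ _ _ threshold
  (measurable_fst : measurable_fun setT threshold).

Definition noise_coord (i : noise_index) (x : R * K.-tuple R) : R :=
  tnth x.2 (enum_rank i).

Lemma measurable_noise_coord i : measurable_fun setT (noise_coord i).
Proof. exact: (measurableT_comp (measurable_tnth (enum_rank i))). Qed.

HB.instance Definition _ i := @isMeasurableFun.Build _ _ _ _ (noise_coord i)
  (measurable_noise_coord i).

(** The release as a deterministic function of threshold and noise, obtained by taking the
    coordinates of the product space as random variables. *)
Definition canonical_release (s : 'I_n -> R) : R * K.-tuple R -> (n - m).+2.-tuple R :=
  release mn s threshold (noise_coord None) (fun v => noise_coord (Some v)).

Lemma measurable_canonical_release s : measurable_fun setT (canonical_release s).
Proof. exact: measurable_release. Qed.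

Lemma release_canonical d (Omega : measurableType d) s
    (tau Y : {mfun Omega >-> R}) (Z : bt_node (n - m) -> {mfun Omega >-> R}) w :
  release mn s tau Y Z w =
  canonical_release s (tau w, [tuple oapp Z Y (enum_val j) w | j < K]).
Proof.
have prefixE : prefix_count mn s tau Y w = prefix_count mn s threshold
    (noise_coord None) (tau w, [tuple oapp Z Y (enum_val j) w | j < K]).
  by rewrite /prefix_count/= /noise_coord tnth_mktuple enum_rankK.
apply: val_inj; rewrite /= -prefixE; congr [:: _, _ & _].
apply: eq_map => k; rewrite /private_count -prefixE; congr (_ + _).
by apply: eq_bigr => v _; rewrite /= /noise_coord tnth_mktuple enum_rankK.
Qed.

(** The change of noise that compensates exactly for replacing [s] by [s'] at threshold [t]. *)
Definition count_shift (s s' : 'I_n -> R) (t : R) (i : noise_index) : R :=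
  if i is Some v then
    node_sum (fun j => Num.min (suffix_stream mn s j) t) v -
    node_sum (fun j => Num.min (suffix_stream mn s' j) t) v
  else \sum_(j < m) Num.min (prefix_stream mn s j) t -
       \sum_(j < m) Num.min (prefix_stream mn s' j) t.

(** Beyond the threshold, the stream enters the release only through the exact sums, and each of
    these is added to its own noise variable; their differences can thus be absorbed into the
    noise. *)
Lemma canonical_release_shift s s' t (z : K.-tuple R) :
  canonical_release s (t, z) = canonical_release s'
    (t, [tuple tnth z j + count_shift s s' t (enum_val j) | j < K]).
Proof.
have prefixE : prefix_count mn s threshold (noise_coord None) (t, z) =
  prefix_count mn s' threshold (noise_coord None)
    (t, [tuple tnth z j + count_shift s s' t (enum_val j) | j < K]).
  rewrite /prefix_count/= /noise_coord tnth_mktuple enum_rankK /=.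
  by ring.
apply: val_inj; rewrite /= -prefixE; congr [:: _, _ & _].
apply: eq_map => k; rewrite /private_count -prefixE; congr (_ + _).
apply: eq_bigr => v _; rewrite /= /noise_coord tnth_mktuple enum_rankK /=.
by ring.
Qed.

Variable b : noise_index -> R.
Hypothesis b_gt0 : forall i, 0 < b i.

Definition release_event s (S : set ((n - m).+2.-tuple R)) : set (R * K.-tuple R) :=
  scale_noise (b \o enum_val) @^-1` (canonical_release s @^-1` S).

Lemma measurable_release_event s S : measurable S ->
  measurable (release_event s S).
Proof.
move=> mS; rewrite -[X in measurable X]setTI; apply: measurable_scale_noise => //.
by rewrite -[X in measurable X]setTI; exact: measurable_canonical_release.
Qed.

(** In units of its scale [t * b i], the noise of index [i] is translated by the count shift over
    [t * b i]. The hypothesis, divided by [t], bounds the total translation of the standard noise by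
    [c]. *)
Lemma release_event_shift s s' S (t c : R) : measurable S -> 0 < t ->
  \sum_i `|count_shift s s' t i| / b i <= t * c ->
  (iid std_laplace K (xsection (release_event s S) t) <=
   (expR c)%:E * iid std_laplace K (xsection (release_event s' S) t))%E.
Proof.
move=> mS t0 tc.
pose a (j : 'I_K) := count_shift s s' t (enum_val j) / (t * b (enum_val j)).
rewrite (_ : xsection (release_event s S) t = [set z |
    xsection (release_event s' S) t [tuple tnth z j + a j | j < K]%R]); last first.
  apply/funext => z; rewrite /xsection/= !in_setE /release_event/=.
  rewrite /scale_noise/= (canonical_release_shift s s').
  congr (S (canonical_release s' (t, _))); apply: eq_from_tnth => j.
  rewrite !tnth_mktuple /= mulrDr /a; congr (_ + _).
  by rewrite mulrCA divff ?mulr1// mulf_neq0 ?gt_eqF.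
apply: le_trans (iid_std_laplace_shift a _) _.
  by apply: measurable_xsection; exact: measurable_release_event.
rewrite lee_wpmul2r// lee_fin ler_expR.
rewrite -(ler_pM2l t0) mulr_sumr; apply: le_trans tc.
rewrite [leRHS](reindex (@enum_val _ {: noise_index}))/=; last first.
  by exists enum_rank => x _; [exact: enum_valK|exact: enum_rankK].
apply: ler_sum => j _; rewrite /a normrM normfV normrM (gtr0_norm t0).
rewrite (gtr0_norm (b_gt0 _)) invfM [X in t * X]mulrCA mulVKf//.
by rewrite gt_eqF.
Qed.

End CanonicalRelease.

(** * Cost of changing one entry of the prefix or of the suffix *)

Section Sensitivity.
Context {R : realType} {m n : nat} (mn : (m <= n)%N) (B : R).
Implicit Types s : 'I_n -> R.

Lemma stream_in_prefix s : stream_in B s -> stream_in B (prefix_stream mn s).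
Proof. by move=> sB i; exact: sB. Qed.

Lemma adjacent_split s s' : Defs.adjacent s s' ->
  (Defs.adjacent (prefix_stream mn s) (prefix_stream mn s') /\
   suffix_stream mn s = suffix_stream mn s') \/
  (prefix_stream mn s = prefix_stream mn s' /\
   Defs.adjacent (suffix_stream mn s) (suffix_stream mn s')).
Proof.
move=> [i [ssi uniq_i]].
have eq_s j : j != i -> s j = s' j.
  by move=> ji; apply: contrapT => /uniq_i ij; rewrite ij eqxx in ji.
have [im|mi] := ltnP i m.
- have iE : widen_ord mn (Ordinal im) = i by exact: val_inj.
  left; split.
    exists (Ordinal im); split; first by rewrite /prefix_stream iE.
    move=> j /uniq_i ij; apply: val_inj; exact: (congr1 val ij).
  apply/funext => j; apply: eq_s; rewrite -val_eqE/=.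
  by rewrite gtn_eqF// ltn_addr.
- have im : (i - m < n - m)%N by rewrite ltn_sub2r// (leq_ltn_trans mi).
  have iE : cast_ord (subnKC mn) (rshift m (Ordinal im)) = i.
    by apply: val_inj; rewrite /= subnKC.
  right; split.
    apply/funext => j; apply: eq_s; rewrite -val_eqE/=.
    by rewrite ltn_eqF// (leq_trans (ltn_ord j)).
  exists (Ordinal im); split; first by rewrite /suffix_stream iE.
  by move=> j /uniq_i ij; apply: val_inj; rewrite /= ij /= addKn.
Qed.

Lemma adjacent_eq N (x y : 'I_N -> R) : Defs.adjacent x y ->
  exists i, forall j, j != i -> x j = y j.
Proof.
move=> [i [_ uniq_i]]; exists i => j ji.
by apply: contrapT => /uniq_i ij; rewrite ij eqxx in ji.
Qed.

Variables (eps2 eps : R).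

(* The noise of index i has scale t * inverse_budget i, t being the threshold. *)
Definition inverse_budget (i : noise_index (m := m) (n := n)) : R :=
  if i is Some _ then (bt_levels (n - m))%:R / eps else eps2^-1.

Lemma sum_count_shift s s' t :
  \sum_i `|count_shift mn s s' t i| / inverse_budget i =
  eps2 * `|count_shift mn s s' t None| +
  eps / (bt_levels (n - m))%:R *
    \sum_(v : bt_node (n - m)) `|count_shift mn s s' t (Some v)|.
Proof.
rewrite big_option /= invrK [X in X + _]mulrC; congr (_ + _).
by rewrite mulr_sumr; apply: eq_bigr => v _; rewrite invf_div mulrC.
Qed.

(** The node sums involve only the suffix and do not move. The clipped prefix sum moves by at most
    [t], weighted by [eps2]. *)
Lemma prefix_count_shift s s' t : 0 < eps2 -> 0 < t ->
  stream_in B s -> stream_in B s' ->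
  Defs.adjacent (prefix_stream mn s) (prefix_stream mn s') ->
  suffix_stream mn s = suffix_stream mn s' ->
  \sum_i `|count_shift mn s s' t i| / inverse_budget i <= t * eps2.
Proof.
move=> e0 t0 sB sB' /adjacent_eq[i ps] ss; rewrite sum_count_shift.
rewrite [X in _ + _ * X]big1; last first.
  by move=> v _; rewrite /count_shift ss subrr normr0.
rewrite mulr0 addr0 mulrC ler_pM2r//.
apply: (clipped_sum_sensitivity (fun=> true) (i := i)) => //.
- by move=> j; have /andP[] := sB (widen_ord mn j).
- by move=> j; have /andP[] := sB' (widen_ord mn j).
- exact: ltW.
Qed.

(** The changed entry lies in exactly [L] nodes, one per level. Each of their sums moves by at most
    [t], weighted by [eps / L], so the number of levels cancels. *)
Lemma suffix_count_shift s s' t : 0 < eps -> 0 < t ->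
  stream_in B s -> stream_in B s' ->
  prefix_stream mn s = prefix_stream mn s' ->
  Defs.adjacent (suffix_stream mn s) (suffix_stream mn s') ->
  \sum_i `|count_shift mn s s' t i| / inverse_budget i <= t * eps.
Proof.
move=> e0 t0 sB sB' ps /adjacent_eq[i ss]; rewrite sum_count_shift.
rewrite {1}/count_shift ps subrr normr0 mulr0 add0r.
have L0 : 0 < (bt_levels (n - m))%:R :> R by rewrite ltr0n.
(* Counting the nodes above an index requires it to be a leaf of the padded tree. *)
have iN : (i < 2 ^ bt_height (n - m))%N.
  by rewrite (leq_trans (ltn_ord i))// up_logP.
apply: (@le_trans _ _ (eps / (bt_levels (n - m))%:R *
    \sum_(v : bt_node (n - m)) (if in_node v i then t else 0))).
  rewrite ler_pM2l ?divr_gt0//; apply: ler_sum => v _.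
  apply: (clipped_sum_sensitivity (fun j => in_node v j)) => //.
  - by move=> j; have /andP[] := sB (cast_ord (subnKC mn) (rshift m j)).
  - by move=> j; have /andP[] := sB' (cast_ord (subnKC mn) (rshift m j)).
  - exact: ltW.
rewrite -big_mkcond/= sumr_const.
have := card_in_node iN; rewrite cardsE => ->.
by rewrite -[t *+ _]mulr_natr mulrCA divfK ?gt_eqF.
Qed.

End Sensitivity.

(** * Privacy of the whole release, by the position of the changed entry *)

Theorem mainTheorem2 (R : realType) (B : R) (m n : nat)
  (eps1 eps2 eps delta : R)
  (B_gt0 : 0 < B) (m_ge1 : (1 <= m)%N) (m_lt_n : (m < n)%N)
  (eps1_gt0 : 0 < eps1) (eps2_gt0 : 0 < eps2) (epsE : eps = eps1 + eps2)
  (delta_ge0 : 0 <= delta)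
  (* A is the threshold algorithm, given by the law of its output. *)
  (A : ('I_m -> R) -> probability R R)
  (A_range : forall s, stream_in B s -> A s `]0, B[%classic = 1%E)
  (A_dp : differentially_private B eps1 delta A)
  (d : measure_display) (Omega : measurableType d)
  (P : ('I_n -> R) -> probability Omega R)
  (tau Y : forall s : 'I_n -> R, {RV (P s) >-> R})
  (Z : forall s : 'I_n -> R, bt_node (n - m) -> {RV (P s) >-> R})
  (tau_law : forall s : 'I_n -> R, stream_in B s ->
     forall U : set R, measurable U ->
       distribution (P s) (tau s) U = A (prefix_stream (ltnW m_lt_n) s) U)
  (YZ_law : forall s : 'I_n -> R, stream_in B s ->
     noise_law B eps2 eps (tau s) (Y s) (Z s)) :
  differentially_private B eps delta
    (fun s => distribution (P s) (release (ltnW m_lt_n) s (tau s) (Y s) (Z s))).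
Proof.
set mn := ltnW m_lt_n.
have eps_gt0 : 0 < eps by rewrite epsE addr_gt0.
pose b := @inverse_budget R m n eps2 eps.
have b_gt0 i : 0 < b i.
  by case: i => [v|]; rewrite /b /= ?invr_gt0// divr_gt0// ltr0n.
pose K := #|{: noise_index (m := m) (n := n)}|.
pose L := iid (@std_laplace R) K.
have tauB s : stream_in B s -> distribution (P s) (tau s) `]0, B[%classic = 1%E.
  by move=> sB; rewrite tau_law// A_range//; exact: stream_in_prefix.
have lawE s S : stream_in B s -> measurable S ->
    distribution (P s) (release mn s (tau s) (Y s) (Z s)) S =
    (distribution (P s) (tau s) \x L)%E (release_event mn b s S).
  move=> sB mS; rewrite -(@noise_joint_law _ _ _ _ _ (P s) (tau s)
    (fun j => oapp (Z s) (Y s) (enum_val j)) B (tauB s sB)) //.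
  - congr (P s _); apply/funext => w /=; rewrite /preimage/=.
    by rewrite release_canonical.
  - by move=> j; exact: b_gt0.
  (* The assumed noise law is reindexed by positions in the tuple: [None] stands for [Y], [Some v]
     for the noise of node [v]. *)
  - move=> U W mU UB mW.
    transitivity (P s [set w | [/\ U (tau s w), W (enum_rank None) (Y s w) &
        forall v, W (enum_rank (Some v)) (Z s v w)]]).
      congr (P s _); apply/seteqP; split => w /=.
        move=> [Uw Ww]; split => // [|v].
          by have := Ww (enum_rank None); rewrite enum_rankK.
        by have := Ww (enum_rank (Some v)); rewrite enum_rankK.
      move=> [Uw Yw Zw]; split => // j.
      by rewrite -{1}(enum_valK j); case: (enum_val j) => [v|].
    apply: etrans (YZ_law s sB U _ _ mU UB (mW (enum_rank None))
      (fun v => mW (enum_rank (Some v)))) _.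
    apply: eq_integral => t _.
    rewrite [RHS](reindex (@enum_rank (noise_index (m := m) (n := n))))/=;
      last by exists enum_val => x _; [exact: enum_rankK|exact: enum_valK].
    rewrite big_option /= enum_rankK; congr (_ * _)%E.
    by apply: eq_bigr => v _; rewrite enum_rankK /b/= mulrA.
  - rewrite -[X in measurable X]setTI.
    exact: measurable_canonical_release.
move=> s s' sB sB' ss' S mS.
rewrite [leLHS](lawE s S sB mS) [X in (_ * X + _)%E](lawE s' S sB' mS).
have mE := measurable_release_event mn b s mS.
have mE' := measurable_release_event mn b s' mS.
have mB : measurable (`]0, B[%classic : set R) by [].
(* Common to both cases: once the threshold has the law it has under [s'], translating the noise
   costs a factor [expR c]. Thresholds outside []0, B[] are null for that law. *)
have shift c : 0 <= c -> (forall t, 0 < t ->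
    \sum_i `|count_shift mn s s' t i| / b i <= t * c) ->
    ((distribution (P s') (tau s') \x L)%E (release_event mn b s S) <=
     (expR c)%:E *
     (distribution (P s') (tau s') \x L)%E (release_event mn b s' S))%E.
  move=> c0 h; rewrite -[leRHS]adde0.
  apply: (le_product_xsection (expR_ge0 _) _ mB (tauB s' sB')) => // t.
  rewrite /= in_itv/= => /andP[t0 _]; rewrite adde0.
  by apply: release_event_shift => //; exact: h.
have [[pp ss]|[ps sp]] := adjacent_split mn ss'.
- (* The threshold is handled before the translation: the other order would
     multiply delta by exp(eps2). *)
  have dp : ((distribution (P s) (tau s) \x L)%E (release_event mn b s S) <=
      (expR eps1)%:E *
      (distribution (P s') (tau s') \x L)%E (release_event mn b s S) + delta%:E)%E.
    (* With the noise fixed, what remains is a measurable set of thresholds, to which the privacy of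
       [A] applies. *)
    apply: le_product_ysection => //.
    move=> y; have my := measurable_ysection y mE.
    rewrite [leLHS](tau_law s sB _ my) [X in (_ * X + _)%E](tau_law s' sB' _ my).
    by apply: A_dp => //; exact: stream_in_prefix.
  apply: (le_trans dp); rewrite leeD2r// epsE expRD EFinM -muleA.
  apply: lee_wpmul2l; first by rewrite lee_fin expR_ge0.
  apply: shift => [|t t0]; first exact: ltW.
  exact: (prefix_count_shift eps _ _ sB sB').
(* Equal prefixes give equal threshold laws, so step (1) costs nothing and all of [eps] is available
   for the tree noise. *)
- have -> : (distribution (P s) (tau s) \x L)%E (release_event mn b s S) =
      (distribution (P s') (tau s') \x L)%E (release_event mn b s S).
    apply: eq_measure_integral => U mU _.
    by rewrite [LHS](tau_law s sB _ mU) [RHS](tau_law s' sB' _ mU) ps.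
  rewrite -[leLHS]adde0; apply: leeD; last by rewrite lee_fin.
  apply: shift => [|t t0]; first exact: ltW.
  exact: (suffix_count_shift eps2 _ _ sB sB').
Qed.
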